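(* Let $\Psi$ and $\bar\Psi$ be two (real-valued) normal bases of the same vector space $\mathcal S=\operatorname{span}_{\mathbb C}(\Psi)=\operatorname{span}_{\mathbb C}(\bar\Psi)$ of functions on $\mathcal X\times\mathcal U$, written as $$\Psi(x,u)=\begin{bmatrix}I\\ G(u)\end{bmatrix}H(x),\qquad \bar\Psi(x,u)=\begin{bmatrix}I\\ \bar G(u)\end{bmatrix}\bar H(x).$$ Given data matrices $X,X^+,U$, assume that $\Psi(X,U)$, $H(X^+)$, $\bar\Psi(X,U)$ and $\bar H(X^+)$ have full row rank. Let $M_{CC}$ and $\bar M_{CC}$ be the control consistency matrices associated with $\Psi$ and $\bar\Psi$, respectively. Then $\operatorname{spec}(M_{CC})=\operatorname{spec}(\bar M_{CC})$.
   Context: System: $x^+=\mathcal T(x,u)$ with $\mathcal T:\mathcal X\times\mathcal U\to\mathcal X$, $\mathcal X\subseteq\mathbb R^n$, $\mathcal U\subseteq\mathbb R^m$. Normal basis: $\Psi:\mathcal X\times\mathcal U\to\mathbb R^{n_\Psi}$ with linearly independent components is in normal form if $\Psi(x,u)=\begin{bmatrix}I\\ G(u)\end{bmatrix}H(x)$ for some $H:\mathcal X\to\mathbb R^{n_{\mathcal H}}$ and $G:\mathcal U\to\mathbb R^{(n_\Psi-n_{\mathcal H})\times n_{\mathcal H}}$, where $I$ is the $n_{\mathcal H}\times n_{\mathcal H}$ identity. A normal space is a space spanned by the components of such a $\Psi$, and $\Psi$ is called a normal basis of it. Data: $X,X^+\in\mathbb R^{n\times N}$, $U\in\mathbb R^{m\times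 N}$ with columns $x_i\in\mathcal X$, $x_i^+$, $u_i\in\mathcal U$ satisfying $x_i^+=\mathcal T(x_i,u_i)$, $i=1,\dots,N$. Write $\Psi(X,U)=[\Psi(x_1,u_1),\dots,\Psi(x_N,u_N)]$, $H(X^+)=[H(x_1^+),\dots,H(x_N^+)]$, and similarly for $\bar\Psi,\bar H$. $^\dagger$ is the Moore–Penrose pseudoinverse. Control consistency matrix of $\Psi$: $M_{CC}=I-A_fA_b$ with $A_f=H(X^+)\Psi(X,U)^\dagger$ and $A_b=\Psi(X,U)H(X^+)^\dagger$; $\bar M_{CC}$ is defined in the same way from $\bar\Psi$ and $\bar H$. $\operatorname{spec}$ denotes the spectrum. *)

(* Defs.v *)
From HB Require Import structures.
From mathcomp Require Import all_boot all_order all_algebra.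
From mathcomp Require Import boolp classical_sets reals.
From mathcomp Require Import complex.

Set Implicit Arguments.
Unset Strict Implicit.
Unset Printing Implicit Defensive.

Import Order.TTheory GRing.Theory Num.Theory.

Local Open Scope classical_set_scope.
Local Open Scope ring_scope.
Local Open Scope complex_scope.

(* A set [X : set 'cV[R]_n] used as a type is the subtype of its elements, so  *)
(* that functions on X or on X * U are not defined outside their domain.       *)

Section PseudoInverse.
Variable R : realType.

(* The four Penrose conditions; over the reals the adjoint is the transpose.   *)
Definition penrose m n (A : 'M[R]_(m, n)) (B : 'M[R]_(n, m)) : Prop :=
  [/\ A *m B *m A = A, B *m A *m B = B,
      (A *m B)^T = A *m B & (B *m A)^T = B *m A].

(* By penrose_pinv and penrose_uniq below, the default value 0 is never taken  *)
(* unless it is the pseudoinverse.                                             *)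
Definition pinv m n (A : 'M[R]_(m, n)) : 'M[R]_(n, m) :=
  xget 0 [set B | penrose A B].

Lemma mulmx_tr_eq0 m n (A : 'M[R]_(m, n)) : A *m A^T = 0 -> A = 0.
Proof.
move=> h; apply/matrixP => i j; rewrite mxE.
have /eqP : (A *m A^T) i i = 0 by rewrite h mxE.
rewrite mxE psumr_eq0; last by move=> k _; rewrite mxE -expr2 sqr_ge0.
by move/allP/(_ j (mem_index_enum j)); rewrite mxE -expr2 sqrf_eq0 => /eqP.
Qed.

Lemma gram_unit m n (A : 'M[R]_(m, n)) : row_free A -> A *m A^T \in unitmx.
Proof.
move=> fA; rewrite -row_free_unit -kermx_eq0.
apply/eqP/(row_free_inj fA); rewrite mul0mx.
apply: mulmx_tr_eq0.
by rewrite trmx_mul !mulmxA -(mulmxA _ A) mulmx_ker mul0mx.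
Qed.

Lemma penrose_ex m n (A : 'M[R]_(m, n)) : exists B, penrose A B.
Proof.
have [r [C [D [AE fC fD]]]] : exists r (C : 'M[R]_(m, r)) (D : 'M[R]_(r, n)),
    [/\ A = C *m D, row_free C^T & row_free D].
  exists (\rank A), (col_base A), (row_base A); split.
  - by rewrite mulmx_base.
  - by rewrite /row_free mxrank_tr; exact: col_base_full.
  - exact: row_base_free.
have uD := gram_unit fD; have := gram_unit fC; rewrite trmxK => uC.
pose P := invmx (C^T *m C); pose Q := invmx (D *m D^T).
have PT : P^T = P by rewrite /P trmx_inv trmx_mul trmxK.
have QT : Q^T = Q by rewrite /Q trmx_inv trmx_mul trmxK.
have AB : A *m (D^T *m Q *m P *m C^T) = C *m P *m C^T.
  by rewrite AE !mulmxA -(mulmxA C D) -(mulmxA C _ Q) mulmxV // mulmx1.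
have BA : (D^T *m Q *m P *m C^T) *m A = D^T *m Q *m D.
  by rewrite AE mulmxA -(mulmxA _ C^T) -(mulmxA _ P) mulVmx // mulmx1.
exists (D^T *m Q *m P *m C^T); split; rewrite ?AB ?BA.
- by rewrite AE mulmxA -(mulmxA _ C^T) -(mulmxA C) mulVmx // mulmx1.
- by rewrite !mulmxA -(mulmxA _ D) -(mulmxA _ (D *m _)) mulmxV // mulmx1.
- by rewrite !trmx_mul trmxK PT mulmxA.
- by rewrite !trmx_mul trmxK QT mulmxA.
Qed.

Lemma penrose_uniq m n (A : 'M[R]_(m, n)) B B' :
  penrose A B -> penrose A B' -> B = B'.
Proof.
move=> [a1 a2 a3 a4] [b1 b2 b3 b4].
have e1 : A *m B = A *m B'.
  by rewrite -{1}b1 -mulmxA -a3 -b3 -trmx_mul mulmxA a1.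
have e2 : B *m A = B' *m A.
  by rewrite -{1}b1 -mulmxA mulmxA -a4 -b4 -trmx_mul -mulmxA (mulmxA A) a1.
by rewrite -a2 e2 -mulmxA e1 mulmxA b2.
Qed.

Lemma penrose_pinv m n (A : 'M[R]_(m, n)) : penrose A (pinv A).
Proof. exact: (xgetPex 0 (penrose_ex A)). Qed.

End PseudoInverse.

Section NormalBasis.
Variable R : realType.

Definition lin_indep (Z : Type) p (f : Z -> 'cV[R]_p) : Prop :=
  forall c : 'rV[R]_p, (forall z, c *m f z = 0) -> c = 0.

Definition spanC (Z : Type) p (f : Z -> 'cV[R]_p) : set (Z -> R[i]) :=
  [set g | exists c : 'I_p -> R[i],
     g = fun z => \sum_(k < p) c k * (f z k 0)%:C].

(* The number of components of Psi is p + q, where p is that of H.             *)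
Definition normal_form n m p q (X : set 'cV[R]_n) (U : set 'cV[R]_m)
    (Psi : X * U -> 'cV[R]_(p + q))
    (G : U -> 'M[R]_(q, p)) (H : X -> 'cV[R]_p) : Prop :=
  lin_indep Psi /\
  forall x u, Psi (x, u) = col_mx 1%:M (G u) *m H x.

Definition normal_basis n m p q (X : set 'cV[R]_n) (U : set 'cV[R]_m)
    (S : set (X * U -> R[i])) (Psi : X * U -> 'cV[R]_(p + q))
    (G : U -> 'M[R]_(q, p)) (H : X -> 'cV[R]_p) : Prop :=
  normal_form Psi G H /\ S = spanC Psi.

End NormalBasis.

Section Consistency.
Variable R : realType.

(* [f(z_1), ..., f(z_N)]. *)
Definition data_mx (Z : Type) p N (f : Z -> 'cV[R]_p) (z : 'I_N -> Z) :
  'M[R]_(p, N) := \matrix_(k < p, i < N) f (z i) k 0.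

(* Here PsiXU = Psi(X, U) and HXp = H(X^+). *)
Definition ccm p r N (PsiXU : 'M[R]_(r, N)) (HXp : 'M[R]_(p, N)) : 'M[R]_p :=
  let Af := HXp *m pinv PsiXU in
  let Ab := PsiXU *m pinv HXp in
  1%:M - Af *m Ab.

Definition spec p (M : 'M[R]_p) : set R[i] :=
  [set z | eigenvalue (map_mx (real_complex R) M) z].

End Consistency.

(* Main.v *)
(** Each of the two bases is the image of the other under a real matrix, by
    taking real parts of the coefficients, so [Psi' = A Psi] with [A] invertible.
    Freezing the input at one value turns this relation into [H' = C H], with [C]
    invertible because the components of [H] and of [H'] are independent.  For
    matrices of full row rank [(A K)^+ = K^+ A^-1], so the factors [A] cancel and
    [M_CC' = C M_CC C^-1].

    The sizes of the two bases are a priori unrelated, so an invertible matrix is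
    a rectangular one given with its two-sided inverse. *)
Require Import Defs.
From mathcomp Require Import all_boot all_order all_algebra.
From mathcomp Require Import boolp classical_sets reals.
From mathcomp Require Import complex.

Import GRing.Theory.

Local Open Scope classical_set_scope.
Local Open Scope ring_scope.
Local Open Scope complex_scope.

Lemma mulmx_pinv {R : realType} {m n} {K : 'M[R]_(m, n)} :
  row_free K -> K *m pinv K = 1%:M.
Proof.
move=> fK; have [KPK _ _ _] := penrose_pinv K.
by apply: (row_free_inj fK); rewrite mul1mx.
Qed.

(** Full row rank gives [K *m pinv K = 1%:M], so one product of [A *m K] and [pinv K *m B] is the
    identity; the other is [pinv K *m K], symmetric by the Penrose conditions for [K]. *)
Lemma pinv_mulmx {R : realType} {m m' n : nat} {A : 'M[R]_(m', m)}
    {B : 'M[R]_(m, m')}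
    {K : 'M[R]_(m, n)} :
  row_free K -> A *m B = 1%:M -> B *m A = 1%:M ->
  pinv (A *m K) = pinv K *m B.
Proof.
move=> fK AB BA; apply: penrose_uniq (penrose_pinv _) _.
have [_ PKP _ PKsym] := penrose_pinv K.
have AK : A *m K *m (pinv K *m B) = 1%:M.
  by rewrite -mulmxA (mulmxA K) (mulmx_pinv fK) mul1mx.
have KA : pinv K *m B *m (A *m K) = pinv K *m K.
  by rewrite -mulmxA (mulmxA B) BA mul1mx.
split; rewrite ?AK ?KA ?mul1mx ?trmx1 //.
by rewrite mulmxA PKP.
Qed.

Lemma data_mx_mulmx {R : realType} {Z : Type} {p p' N : nat} {A : 'M[R]_(p', p)}
    {f : Z -> 'cV[R]_p} {g : Z -> 'cV[R]_p'} (z : 'I_N -> Z) :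
  (forall y, g y = A *m f y) -> data_mx g z = A *m data_mx f z.
Proof.
move=> gE; apply/matrixP => k i; rewrite mxE gE !mxE.
by apply: eq_bigr => j _; rewrite mxE.
Qed.

Lemma ccm_mulmx {R : realType} {p p' r r' N : nat}
    {C : 'M[R]_(p', p)} {D : 'M[R]_(p, p')}
    {A : 'M[R]_(r', r)} {B : 'M[R]_(r, r')}
    {K : 'M[R]_(r, N)} {L : 'M[R]_(p, N)} :
  row_free K -> row_free L ->
  C *m D = 1%:M -> D *m C = 1%:M -> A *m B = 1%:M -> B *m A = 1%:M ->
  ccm (A *m K) (C *m L) = C *m ccm K L *m D.
Proof.
move=> fK fL CD DC AB BA; rewrite /ccm (pinv_mulmx fK AB BA).
rewrite (pinv_mulmx fL CD DC) mulmxBr mulmxBl mulmx1 CD; congr (_ - _).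
by rewrite !mulmxA -(mulmxA _ B A) BA mulmx1.
Qed.

(** Eigenvectors are rows here: right multiplication by [C] carries those of [C *m M *m D] to those
    of [M], and [D] undoes it, so none is sent to zero. *)
Lemma spec_sub_conj {R : realType} {p p' : nat}
    {C : 'M[R]_(p', p)} {D : 'M[R]_(p, p')}
    {M : 'M[R]_p} :
  C *m D = 1%:M -> D *m C = 1%:M -> spec (C *m M *m D) `<=` spec M.
Proof.
move=> CD DC z /= /eigenvalueP[v vM v0]; apply/eigenvalueP.
pose Cz := map_mx (real_complex R) C; pose Dz := map_mx (real_complex R) D.
have CDz : Cz *m Dz = 1%:M by rewrite -map_mxM CD map_mx1.
have DCz : Dz *m Cz = 1%:M by rewrite -map_mxM DC map_mx1.
exists (v *m Cz).
  rewrite scalemxAl -vM !map_mxM -/Cz -/Dz.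
  by rewrite !mulmxA -(mulmxA _ Dz) DCz mulmx1.
apply: contraNneq v0 => vC0.
by rewrite -(mulmx1 v) -CDz mulmxA vC0 mul0mx.
Qed.

Lemma spec_conj {R : realType} {p p' : nat}
    {C : 'M[R]_(p', p)} {D : 'M[R]_(p, p')}
    {M : 'M[R]_p} :
  C *m D = 1%:M -> D *m C = 1%:M -> spec (C *m M *m D) = spec M.
Proof.
move=> CD DC; apply/seteqP; split; first exact: spec_sub_conj.
(* The reverse inclusion is the same lemma with [C] and [D] exchanged. *)
have {1}-> : M = D *m (C *m M *m D) *m C.
  by rewrite !mulmxA DC mul1mx -mulmxA DC mulmx1.
exact: spec_sub_conj.
Qed.

Lemma spanC_sub_mulmx {R : realType} {Z : Type} {p p'} {f : Z -> 'cV[R]_p}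
    {g : Z -> 'cV[R]_p'} :
  spanC g `<=` spanC f -> exists A : 'M[R]_(p', p), forall z, g z = A *m f z.
Proof.
move=> gf.
have coef (k : 'I_p') : exists c : 'I_p -> R[i],
    (fun z => (g z k 0)%:C) = fun z => \sum_(j < p) c j * (f z j 0)%:C.
  (* Kronecker delta coefficients put the component [k] of [g] in its own span. *)
  apply: gf; exists (fun j => (j == k)%:R); apply/funext => z.
  rewrite (bigD1 k) //= eqxx mul1r big1 ?addr0 // => j /negPf->.
  by rewrite mul0r.
have [c cE] := choice coef.
exists (\matrix_(k, j) complex.Re (c k j)) => z.
apply/matrixP => k j; rewrite (ord1 j) mxE.
(* Both families are real-valued, so taking real parts only changes the coefficients. *)
have /(congr1 (@complex.Re R)) /= := congr1 (fun h => h z) (cE k).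
rewrite raddf_sum /= => ->; apply: eq_bigr => i _; rewrite mxE.
by case: (c k i) => a b /=; rewrite mulr0 subr0.
Qed.

Lemma lin_indep_mulmx_inj {R : realType} {Z : Type} {p r} {f : Z -> 'cV[R]_p}
    {A B : 'M[R]_(r, p)} :
  lin_indep f -> (forall z, A *m f z = B *m f z) -> A = B.
Proof.
move=> fI AB; apply/row_matrixP => k; apply/eqP; rewrite -subr_eq0; apply/eqP.
by apply: fI => z; rewrite mulmxBl -!row_mul AB subrr.
Qed.

Lemma lin_indep_mulmxV {R : realType} {Z : Type} {p p' : nat} {f : Z -> 'cV[R]_p}
    {g : Z -> 'cV[R]_p'} {A : 'M[R]_(p', p)} {B : 'M[R]_(p, p')} :
  lin_indep f -> (forall z, g z = A *m f z) -> (forall z, f z = B *m g z) ->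
  B *m A = 1%:M.
Proof.
move=> fI gE fE; apply: (lin_indep_mulmx_inj fI) => z.
by rewrite -mulmxA -gE -fE mul1mx.
Qed.

Section NormalForm.
Context {R : realType} {n m : nat} {X : set 'cV[R]_n} {U : set 'cV[R]_m}.

(** The top block of [Psi] is [H], so a relation on [H], padded with zeros, is a relation on
    [Psi]. *)
Lemma normal_form_lin_indep {p q} {Psi : X * U -> 'cV[R]_(p + q)}
    {G : U -> 'M[R]_(q, p)} {H : X -> 'cV[R]_p} :
  normal_form Psi G H -> lin_indep H.
Proof.
move=> [PsiI PsiE] c cH.
have c0 : row_mx c (0 : 'rV[R]_q) = 0.
  apply: PsiI => -[x u]; rewrite PsiE mulmxA mul_row_col mulmx1 mul0mx addr0.
  exact: cH.
by rewrite -(row_mxKl c (0 : 'rV[R]_q)) c0 linear0.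
Qed.

Lemma normal_form_mulmx {p q p' q'}
    {Psi : X * U -> 'cV[R]_(p + q)} {G : U -> 'M[R]_(q, p)} {H : X -> 'cV[R]_p}
    {Psi' : X * U -> 'cV[R]_(p' + q')} {G' : U -> 'M[R]_(q', p')}
    {H' : X -> 'cV[R]_p'} {A : 'M[R]_(p' + q', p + q)} :
  normal_form Psi G H -> normal_form Psi' G' H' ->
  (forall z, Psi' z = A *m Psi z) ->
  exists C : 'M[R]_(p', p), forall x, H' x = C *m H x.
Proof.
move=> [_ PsiE] nf' AE; have [_ PsiE'] := nf'.
have [[u0 _]|noU] := pselect (exists u : U, True).
  (* The top rows of [Psi' (x, u0) = A *m Psi (x, u0)] read [H' x] on the left. *)
  exists (usubmx A *m col_mx 1%:M (G u0)) => x.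
  rewrite -mulmxA -PsiE mul_usub_mx -AE PsiE' mul_col_mx mul1mx.
  by rewrite col_mxKu.
(* Without inputs, independence forces [p' = 0]. *)
have c0 (c : 'rV[R]_(p' + q')) : c = 0.
  by apply: nf'.1 => -[x u]; case: noU; exists u.
exists 0 => x; rewrite mul0mx; apply: trmx_inj; rewrite trmx0.
by rewrite -(row_mxKl (H' x)^T (0 : 'rV[R]_q')) (c0 (row_mx _ _)) linear0.
Qed.

End NormalForm.

Theorem mainTheorem3 (R : realType) (n m N : nat)
    (X : set 'cV[R]_n) (U : set 'cV[R]_m) (T : X * U -> X)
    (S : set (X * U -> R[i]))
    (p q p' q' : nat)
    (Psi : X * U -> 'cV[R]_(p + q))
    (G : U -> 'M[R]_(q, p)) (H : X -> 'cV[R]_p)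
    (Psi' : X * U -> 'cV[R]_(p' + q'))
    (G' : U -> 'M[R]_(q', p')) (H' : X -> 'cV[R]_p')
    (hPsi : normal_basis S Psi G H)
    (hPsi' : normal_basis S Psi' G' H')
    (x xp : 'I_N -> X) (u : 'I_N -> U)
    (hdata : forall i, xp i = T (x i, u i))
    (rPsi : row_free (data_mx Psi (fun i => (x i, u i))))
    (rH : row_free (data_mx H xp))
    (rPsi' : row_free (data_mx Psi' (fun i => (x i, u i))))
    (rH' : row_free (data_mx H' xp)) :
  spec (ccm (data_mx Psi (fun i => (x i, u i))) (data_mx H xp)) =
  spec (ccm (data_mx Psi' (fun i => (x i, u i))) (data_mx H' xp)).
Proof.
have [[nf SE] [nf' SE']] := (hPsi, hPsi').
have [A AE] : exists A : 'M[R]_(p' + q', p + q), forall z, Psi' z = A *m Psi z.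
  by apply: spanC_sub_mulmx; rewrite -SE -SE'.
have [B BE] : exists B : 'M[R]_(p + q, p' + q'), forall z, Psi z = B *m Psi' z.
  by apply: spanC_sub_mulmx; rewrite -SE -SE'.
have [C CE] := normal_form_mulmx nf nf' AE.
have [D DE] := normal_form_mulmx nf' nf BE.
have AB := lin_indep_mulmxV nf'.1 BE AE.
have BA := lin_indep_mulmxV nf.1 AE BE.
(* [C] and [D] were obtained separately; independence of [H'] and of [H] makes them mutually
   inverse. *)
have CD := lin_indep_mulmxV (normal_form_lin_indep nf') DE CE.
have DC := lin_indep_mulmxV (normal_form_lin_indep nf) CE DE.
rewrite (data_mx_mulmx _ AE) (data_mx_mulmx _ CE).
by rewrite (ccm_mulmx rPsi rH CD DC AB BA) spec_conj.
Qed.
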